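(* There is a constant $C$ such that for every sequence length $N\ge1$ there exist a precision $p\le C\max\{1,\log N\}$ and a third-order graph transformer $f\in\mathcal{TG}^{1,1,\otimes3}_{N,1,1,p}$ with a single graph self-attention unit (embedding dimension $1$) such that $f(X)=\mathrm{DirectedCycle3}(X)$ for all $X\in\{0,1\}^{N\times N}$ (where $f$ may use a positional encoding and a single appended blank token, as specified in the context).
   Context: The input $X\in\{0,1\}^{N\times N}$ is the adjacency matrix of a directed graph on $[N]=\{1,\dots,N\}$, $x_{i,j}=1$ iff $(i,j)$ is an edge; row $x_i$ is the embedding of vertex $i$. $\mathrm{DirectedCycle3}(X)\in\{0,1\}^N$ is given by $\mathrm{DirectedCycle3}(X)_i=1$ if there exist $j_1,j_2\in[N]$ with $x_{i,j_1}x_{j_1,j_2}x_{j_2,i}=1$, and $0$ otherwise. Tensor notation. $(v^1\otimes v^2)_{(i_1-1)N_2+i_2}=v^1_{i_1}v^2_{i_2}$ for $v^1\in\mathbb{R}^{N_1},v^2\in\mathbb{R}^{N_2}$; for matrices with $m$ columns, $A^1\star A^2=[A^1_1\otimes A^2_1\mid\cdots\mid A^1_m\otimes A^2_m]$ (column-wise Kronecker product). $s$-order graph self-attention. Let $X$ be the adjacency matrix given as input to the network and $Y\in\mathbb{R}^{N\times d}$ the current embeddings. For $Q,K^1,\dots,K^{s-1}\in\mathbb{R}^{d\times m}$, $V^1,\dots,V^{s-1}\in\mathbb{R}^{d\times d'}$ encoded with $p$-bit fixed-point numbers and a function $\kappa:\{0,1\}^{s(s-1)}\times\mathbb{R}\to\mathbb{R}$,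 the unit outputs $$\mathrm{softmax}\big(\kappa(X,YQ((YK^1)\star\cdots\star(YK^{s-1}))^{\mathsf T})\big)\big((YV^1)\star\cdots\star(YV^{s-1})\big)\in\mathbb{R}^{N\times d'},$$ where the attention matrix is viewed as a tensor $A$ indexed by $(i_1,\dots,i_s)\in[N]^s$ ($i_1$ the row, $(i_2,\dots,i_s)$ the column), $\kappa(X,A)_{i_1,\dots,i_s}=\kappa\big((x_{i_a,i_b})_{a\neq b\in[s]},A_{i_1,\dots,i_s}\big)$, and softmax is row-wise, $\mathrm{softmax}(A)_{i,j}=\exp(A_{i,j})/\sum_{j'}\exp(A_{i,j'})$. MLP layer. $\Phi_{d,d',p}$ is the set of all (arbitrary) functions $\phi:\mathbb{R}^d\to\mathbb{R}^{d'}$ whose real-valued inputs and outputs can be represented using $p$-bit fixed-precision numbers, applied row-wise. $\mathcal{TG}^{1,1,\otimes s}_{d,m,d',p}$ is the set of compositions of an input MLP in $\Phi_{d,m,p}$, one $s$-order graph self-attention unit with input, embedding and output dimensions all $m$, and an output MLP in $\Phi_{m,d',p}$. Conventions. Positional encoding: MLPs may depend on the index $i$. Blank token: a single constant token may be appended to the sequence as element $N+1$, with all edge indicators involving it equal to $0$; the output is read off the first $N$ elements. *)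

(* Defs.v *)
From HB Require Import structures.
From mathcomp Require Import all_boot all_order all_algebra.
From mathcomp Require Import mxtens.
From mathcomp Require Import reals sequences exp.

Set Implicit Arguments.
Unset Strict Implicit.
Unset Printing Implicit Defensive.

Import Order.TTheory GRing.Theory Num.Theory.
Local Open Scope ring_scope.

(* {0,1}-valued matrices are boolean matrices; X i j is the edge i -> j, and
   nothing is assumed about the diagonal of X.  Indices start at 0. *)

Definition DirectedCycle3 (R : realType) (N : nat) (X : 'M[bool]_N) : 'cV[R]_N :=
  \col_i ([exists j1, exists j2, [&& X i j1, X j1 j2 & X j2 i]] : bool)%:R.

Section FixedPoint.
Variables (R : realType) (p q : nat).

(* Signed (two's complement) p-bit words, q of the bits being fractional. *)
Definition fixed_format : bool := (0 < p)%N && (q <= p)%N.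

Definition fixed_point (x : R) : Prop :=
  exists2 k : int, - 2 ^+ p.-1 <= k < 2 ^+ p.-1 & x = k%:~R / 2 ^+ q.

(* Rounding to the nearest fixed-point number, saturating on overflow. *)
Definition fixed_round (x : R) : R :=
  (Num.max (- 2 ^+ p.-1)
     (Num.min (2 ^+ p.-1 - 1) (Num.floor (x * 2 ^+ q + 2^-1))))%:~R / 2 ^+ q.

Definition fixed_mx (m n : nat) (A : 'M[R]_(m, n)) : Prop :=
  forall i j, fixed_point (A i j).

(* An arbitrary function that sees its input only through its fixed-point
   representation, and whose outputs are fixed-point numbers. *)
Definition fixed_mlp (d d' : nat) (phi : 'rV[R]_d -> 'rV[R]_d') : Prop :=
  forall x, phi x = phi (map_mx fixed_round x) /\ fixed_mx (phi x).

End FixedPoint.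

(* With a positional encoding, the MLP applied to row i may depend on i. *)
Definition mlp_layer (R : realType) (n d d' : nat)
    (phi : 'I_n -> 'rV[R]_d -> 'rV[R]_d') (Y : 'M[R]_(n, d)) : 'M[R]_(n, d') :=
  \matrix_(i < n) phi i (row i Y).

Definition softmax (R : realType) (m n : nat) (A : 'M[R]_(m, n)) : 'M[R]_(m, n) :=
  \matrix_(i, j) (expR (A i j) / \sum_j' expR (A i j')).

(* Column-wise Kronecker product; mxtens_index (i1, i2) has value i1 * n2 + i2. *)
Definition colkron (R : realType) (n1 n2 m : nat)
    (A : 'M[R]_(n1, m)) (B : 'M[R]_(n2, m)) : 'M[R]_(n1 * n2, m) :=
  \matrix_(r, c) (A (mxtens_unindex r).1 c * B (mxtens_unindex r).2 c).

(* A 0 * (A 1 * ... * A k), with colkron for *.  The type uses that N ^ 1 and N,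
   and N ^ k.+2 and N * N ^ k.+1, are convertible. *)
Fixpoint colkrons (R : realType) (N m k : nat) :
    ('I_k.+1 -> 'M[R]_(N, m)) -> 'M[R]_(N ^ k.+1, m) :=
  match k with
  | 0 => fun A => A ord0
  | k'.+1 => fun A =>
      colkron (A ord0) (colkrons (fun a : 'I_k'.+1 => A (lift ord0 a)))
  end.

Definition fcons (T : Type) (n : nat) (x : T) (g : 'I_n -> T) (a : 'I_n.+1) : T :=
  if unlift ord0 a is Some b then g b else x.

(* The multi-index in [N]^(k+1) of a row of colkrons. *)
Fixpoint tensor_index (N k : nat) : 'I_(N ^ k.+1) -> 'I_k.+1 -> 'I_N :=
  match k with
  | 0 => fun c _ => c
  | k'.+1 => fun c : 'I_(N * N ^ k'.+1) =>
      fcons (mxtens_unindex c).1 (tensor_index (mxtens_unindex c).2)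
  end.

(* The s (s - 1) ordered pairs (a, b) with a <> b in [s]. *)
Definition edge_pair (s : nat) := {ab : 'I_s * 'I_s | ab.1 != ab.2}.

Section GraphAttention.
(* The order is s = k + 2. *)
Variables (R : realType) (k n d m d' : nat).
Variable kappa : {ffun edge_pair k.+2 -> bool} -> R -> R.

(* Entrywise application of kappa; the entry (i, c) of A is the entry
   (i_1, ..., i_s) = (i, tensor_index c) of the tensor. *)
Definition graph_kernel (X : 'M[bool]_n) (A : 'M[R]_(n, n ^ k.+1)) :
    'M[R]_(n, n ^ k.+1) :=
  \matrix_(i, c)
    let t := fcons i (tensor_index c) in
    kappa [ffun ab : edge_pair k.+2 => X (t (val ab).1) (t (val ab).2)] (A i c).

Definition graph_attention (Q : 'M[R]_(d, m)) (K : 'I_k.+1 -> 'M[R]_(d, m))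
    (V : 'I_k.+1 -> 'M[R]_(d, d')) (X : 'M[bool]_n) (Y : 'M[R]_(n, d)) :
    'M[R]_(n, d') :=
  softmax (graph_kernel X (Y *m Q *m (colkrons (fun a => Y *m K a))^T))
    *m colkrons (fun a => Y *m V a).

End GraphAttention.

(* b : bool counts the blank tokens: the sequence has length N + b. *)
Definition pad_graph (N : nat) (b : bool) (X : 'M[bool]_N) : 'M[bool]_(N + b) :=
  block_mx X (const_mx false) (const_mx false) (const_mx false).

Definition pad_input (R : realType) (N : nat) (b : bool) (blank : 'rV[R]_N)
    (X : 'M[bool]_N) : 'M[R]_(N + b, N) :=
  col_mx (map_mx (fun e : bool => e%:R) X) (\matrix_(i < b) blank).

(* TG s N m d' p f: f belongs to the class TG^{1,1,(x)s}_{N,m,d',p}, of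
   functions on adjacency matrices of graphs on N vertices. *)
Definition TG (R : realType) (s N m d' p : nat)
    (f : 'M[bool]_N -> 'M[R]_(N, d')) : Prop :=
  exists2 k, s = k.+2 &
  exists (q : nat) (b : bool) (blank : 'rV[R]_N)
    (phi_in : 'I_(N + b) -> 'rV[R]_N -> 'rV[R]_m)
    (Q : 'M[R]_m) (K V : 'I_k.+1 -> 'M[R]_m)
    (kappa : {ffun edge_pair k.+2 -> bool} -> R -> R)
    (phi_out : 'I_(N + b) -> 'rV[R]_m -> 'rV[R]_d'),
  [/\ [/\ fixed_format p q, fixed_mx p q blank,
          forall i, fixed_mlp p q (phi_in i)
        & forall i, fixed_mlp p q (phi_out i)],
      [/\ fixed_mx p q Q, forall a, fixed_mx p q (K a)
        & forall a, fixed_mx p q (V a)]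
    & forall X, f X =
        usubmx (mlp_layer phi_out
          (graph_attention kappa Q K V (pad_graph b X)
            (mlp_layer phi_in (pad_input b blank X))))].
Arguments TG {R} s N m d' p f.

(* Main.v *)
Require Import Defs.
From mathcomp Require Import all_boot all_order all_algebra.
From mathcomp Require Import mxtens zify lra.
From mathcomp Require Import reals sequences exp.
Local Open Scope ring_scope.

(* The embedding of a vertex is 1 and that of the blank token is 0, so for a
   vertex i the score and the value of a pair (j1, j2) are both 1 if j1 and j2
   are vertices, and 0 otherwise.  With M = (N + 1) ^ 2 the number of pairs,
   kappa raises the score to M on 3-cycles, lowers it to - M on the other
   triples of vertices, and keeps 0 on the triples with a blank token.  The
   total weight of the pairs with a blank token lies between 1 and M, hence it
   is at most exp M if there is a cycle through i, and larger than M exp (- M)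
   otherwise: the output of the attention is at least 1/2 exactly when there is
   a cycle, and rounding it to an integer gives the result.  The precision
   p = 2 is enough because kappa is not subject to any precision constraint. *)

Set Implicit Arguments.
Unset Strict Implicit.
Unset Printing Implicit Defensive.
Import Order.TTheory GRing.Theory Num.Theory.

Section FixedPointTheory.
Variables (R : realType) (p q : nat).

Lemma fixed_point_round (x : R) : fixed_point p q (fixed_round p q x).
Proof.
eexists; last reflexivity.
have P : (0 : int) < 2 ^+ p.-1 by rewrite exprn_gt0.
rewrite le_max lexx /= gt_max; apply/andP; split; first by lia.
rewrite gt_min; apply/orP; left; by lia.
Qed.

Lemma fixed_round_id (x : R) : fixed_point p q x -> fixed_round p q x = x.
Proof.
case=> k /andP[k1 k2] ->; rewrite /fixed_round.
have P : (2 : R) ^+ q != 0 by rewrite expf_neq0 ?pnatr_eq0.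
rewrite divfK //.
have -> : Num.floor (k%:~R + 2^-1 : R) = k.
  by apply/floor_def; rewrite intrD; apply/andP; split; lra.
by rewrite min_r ?max_r //; lia.
Qed.

Lemma fixed_mx_map_round m n (A : 'M[R]_(m, n)) :
  fixed_mx p q (map_mx (fixed_round p q) A).
Proof. by move=> i j; rewrite mxE; apply: fixed_point_round. Qed.

Lemma fixed_mlp_map_round n :
  fixed_mlp p q (map_mx (fixed_round p q) : 'rV[R]_n -> 'rV[R]_n).
Proof.
move=> x; split; last exact: fixed_mx_map_round.
by apply/matrixP=> i j; rewrite !mxE (fixed_round_id (fixed_point_round _)).
Qed.

End FixedPointTheory.

Lemma fixed_point_bool (R : realType) (b : bool) :
  fixed_point 2 0 (b%:R : R).
Proof. by exists b%:R; rewrite ?expr0 ?divr1 //; case: b. Qed.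

(** With two bits and none fractional, the format is {-2, -1, 0, 1}, so 1 is not cut off by
    saturation. The tie at 1/2 rounds up, which makes the threshold non-strict. *)
Lemma fixed_round_half (R : realType) (x : R) :
  0 <= x <= 1 -> fixed_round 2 0 x = (2^-1 <= x)%R%:R.
Proof.
move=> /andP[x0 x1]; rewrite /fixed_round expr0 mulr1 divr1.
have [h|h] := leP.
  have -> : Num.floor (x + 2^-1) = 1 by apply/floor_def; rewrite intrD; lra.
  by [].
have -> : Num.floor (x + 2^-1) = 0 by apply/floor_def; rewrite add0r; lra.
by [].
Qed.

Section WeightedMean.
Variables (R : realType) (I : finType) (w : I -> R) (v : pred I).

Let mean := \sum_c w c / (\sum_c' w c') * (v c)%:R.

Hypothesis w_ge0 : forall c, 0 <= w c.

Lemma weighted_meanE :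
  mean = (\sum_(c | v c) w c) / (\sum_(c | v c) w c + \sum_(c | ~~ v c) w c).
Proof.
rewrite -(bigID v predT) /= mulr_suml big_mkcond /=; apply: eq_bigr => c _.
by case: (v c); rewrite ?mulr1 ?mulr0.
Qed.

Lemma weighted_mean_ge0_le1 : 0 <= mean <= 1.
Proof.
rewrite weighted_meanE.
have : 0 <= \sum_(c | v c) w c by apply: sumr_ge0.
have : 0 <= \sum_(c | ~~ v c) w c by apply: sumr_ge0.
move: (\sum_(c | v c) w c) (\sum_(c | ~~ v c) w c) => a b b0 a0.
rewrite divr_ge0 ?addr_ge0 //=.
(* If the total weight is 0, so is the mean, because the inverse of 0 is 0. *)
have [->|ab] := eqVneq (a + b) 0; first by rewrite invr0 mulr0.
by rewrite ler_pdivrMr ?lt0r ?ab ?addr_ge0 // mul1r lerDl.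
Qed.

(** A positive second sum makes the total positive, so the denominator can be cleared; with both
    sums 0 the equivalence would fail. *)
Lemma weighted_mean_ge_half : 0 < \sum_(c | ~~ v c) w c ->
  (2^-1 <= mean) = (\sum_(c | ~~ v c) w c <= \sum_(c | v c) w c).
Proof.
rewrite weighted_meanE.
have : 0 <= \sum_(c | v c) w c by apply: sumr_ge0.
move: (\sum_(c | v c) w c) (\sum_(c | ~~ v c) w c) => a b a0 b0.
rewrite ler_pdivlMr; last by lra.
by apply/idP/idP; lra.
Qed.

End WeightedMean.

Definition pair01 : edge_pair 3 := exist _ (0, 1) isT.
Definition pair12 : edge_pair 3 := exist _ (1, 2%:R) isT.
Definition pair20 : edge_pair 3 := exist _ (2%:R, 0) isT.

(** Edge bits cannot tell the blank token from an isolated vertex, but the score can: in the row of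
    a vertex, [a == 0] marks the triples with a blank. *)
Definition cycle_kappa (R : realType) (M : nat)
    (e : {ffun edge_pair 3 -> bool}) (a : R) : R :=
  if a == 0 then 0
  else if [&& e pair01, e pair12 & e pair20] then M%:R else - M%:R.

Definition vertex_indicator (R : realType) (N n : nat) (i : 'I_n)
  (_ : 'rV[R]_N) : 'rV[R]_1 := const_mx (i < N)%:R.

Local Notation fst_index c := (tensor_index (k := 1) c ord0).
Local Notation snd_index c := (tensor_index (k := 1) c ord_max).

Section CycleAttention.
Variables (R : realType) (N : nat) (X : 'M[bool]_N).
Let n := (N + true)%N.
Let Y : 'M[R]_(n, 1) := \matrix_(i, _) (i < N)%:R.
Let M := (n ^ 2)%N.

Definition cycle_attention : 'M[R]_(n, 1) :=
  @graph_attention R 1 n 1 1 1 (cycle_kappa M) 1%:M (fun=> 1%:M) (fun=> 1%:M)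
    (pad_graph true X) Y.

Let vertices (c : 'I_(n ^ 2)) : bool :=
  (fst_index c < N)%N && (snd_index c < N)%N.

Let closes (i : 'I_n) (c : 'I_(n ^ 2)) : bool :=
  let j1 := fst_index c in
  let j2 := snd_index c in
  let E := pad_graph true X in [&& E i j1, E j1 j2 & E j2 i].

Let weight i c : R :=
  expR (if vertices c then if closes i c then M%:R else - M%:R else 0).

(** Query, key and value matrices are the scalar 1, so keys and values are the same products of two
    vertex indicators, and the query factor is 1 because [i] is a vertex. *)
Lemma cycle_attentionE (i : 'I_n) : (i < N)%N ->
  cycle_attention i 0 =
  \sum_c weight i c / (\sum_c' weight i c') * (vertices c)%:R.
Proof.
move=> iN; rewrite /cycle_attention /graph_attention mxE.
have valE c : colkrons (k := 1) (fun=> Y *m 1%:M) c 0 = (vertices c)%:R.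
  rewrite mulmx1 /= !mxE /vertices /= /fcons unlift_none.
  rewrite (_ : ord_max = lift ord0 ord0) ?liftK; last exact/val_inj.
  by rewrite -natrM mulnb.
have kerE c : expR (graph_kernel (k := 1) (cycle_kappa M) (pad_graph true X)
    (Y *m 1%:M *m (colkrons (k := 1) (fun=> Y *m 1%:M))^T) i c) = weight i c.
  rewrite mxE mxE big_ord1 [X in _ * X]mxE ord1 valE mulmx1 mxE iN mul1r.
  rewrite /cycle_kappa /weight; congr expR.
  case: (vertices c); rewrite ?eqxx ?oner_eq0 // !ffunE /=.
  rewrite /closes /=.
  have t0 : fcons i (tensor_index (k := 1) c) 0 = i.
    by rewrite /fcons unlift_none.
  have t1 : fcons i (tensor_index (k := 1) c) 1 = fst_index c.
    by rewrite {1}/fcons (_ : 1 = lift ord0 ord0) ?liftK //; apply/val_inj.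
  have t2 : fcons i (tensor_index (k := 1) c) 2%:R = snd_index c.
    by rewrite {1}/fcons (_ : 2%:R = lift ord0 ord_max) ?liftK //; apply/val_inj.
  by rewrite t0 t1 t2.
apply: eq_bigr => c _; rewrite valE mxE kerE; congr (_ / _ * _).
by apply: eq_bigr => c' _; rewrite kerE.
Qed.

Lemma tensor_index_surj (j1 j2 : 'I_n) :
  exists c, fst_index c = j1 /\ snd_index c = j2.
Proof.
exists (mxtens_index (j1, j2 : 'I_(n ^ 1))).
have [e1 e2] := mxtens_indexK (j1, j2 : 'I_(n ^ 1)).
rewrite /= /fcons unlift_none; split; first exact: e1.
by rewrite (_ : ord_max = lift ord0 ord0) ?liftK; [exact: e2|exact/val_inj].
Qed.

Lemma pad_graph_lshift (i j : 'I_N) :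
  pad_graph true X (lshift true i) (lshift true j) = X i j.
Proof. by rewrite /pad_graph block_mxEul. Qed.

Lemma closes_exists (i : 'I_N) :
  [exists c, vertices c && closes (lshift true i) c]
  = [exists j1, exists j2, [&& X i j1, X j1 j2 & X j2 i]].
Proof.
apply/existsP/existsP => [[c /andP[/andP[v1 v2]]]|[j1 /existsP[j2 h]]].
  have e1 : fst_index c = lshift true (Ordinal v1) by apply/val_inj.
  have e2 : snd_index c = lshift true (Ordinal v2) by apply/val_inj.
  rewrite /closes e1 e2 !pad_graph_lshift => h.
  by exists (Ordinal v1); apply/existsP; exists (Ordinal v2).
have [c [e1 e2]] := tensor_index_surj (lshift true j1) (lshift true j2).
exists c; rewrite /vertices /closes e1 e2 !pad_graph_lshift h andbT /=.
by rewrite !ltn_ord.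
Qed.

Lemma blank_weightE i :
  \sum_(c | ~~ vertices c) weight i c = #|[pred c | ~~ vertices c]|%:R.
Proof.
rewrite -sumr_const; apply: eq_bigr => c /negPf h.
by rewrite /weight h expR0.
Qed.

(** The witness is the pair made of the blank token twice. *)
Lemma blank_card_gt0 : (0 < #|[pred c | ~~ vertices c]|)%N.
Proof.
have bN : (N < n)%N by rewrite /n addn1.
have [c [e1 e2]] := tensor_index_surj (Ordinal bN) (Ordinal bN).
by apply/card_gt0P; exists c; rewrite inE /vertices e1 ltnn.
Qed.

Lemma blank_card_le : (#|[pred c | ~~ vertices c]| <= M)%N.
Proof. by rewrite (leq_trans (max_card _)) // card_ord. Qed.

Lemma cycle_attention_weightP (i : 'I_N) :
  (\sum_(c | ~~ vertices c) weight (lshift true i) c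
     <= \sum_(c | vertices c) weight (lshift true i) c)
  = [exists j1, exists j2, [&& X i j1, X j1 j2 & X j2 i]].
Proof.
rewrite blank_weightE -closes_exists.
(* This serves both cases: one closing pair weighs exp M > M, and M pairs of weight exp (- M) weigh
   less than 1 together. *)
have expM : (M%:R : R) < expR M%:R.
  by rewrite (lt_le_trans _ (expR_ge1Dx _)) // ltrDr.
case: existsP => [[c /andP[vc cc]]|noc].
  apply: (@le_trans _ _ M%:R); first by rewrite ler_nat blank_card_le.
  rewrite (bigD1 c) //= {1}/weight vc cc (le_trans (ltW expM)) //.
  by rewrite lerDl sumr_ge0 // => ? _; apply: expR_ge0.
apply/negbTE; rewrite -ltNge.
apply: (@lt_le_trans _ _ 1); last by rewrite ler1n blank_card_gt0.
(* Without a cycle all vertex pairs weigh exp (- M); the sum is enlarged to all M pairs. *)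
apply: (@le_lt_trans _ _ (\sum_(c : 'I_(n ^ 2)) expR (- M%:R))).
  rewrite big_mkcond; apply: ler_sum => c _.
  case: ifP => vc; last exact: expR_ge0.
  rewrite /weight vc; case: ifP => // cc; case: noc; exists c.
  by rewrite vc cc.
by rewrite sumr_const card_ord -[ltLHS]mulr_natl expRN ltr_pdivrMr ?expR_gt0 ?mul1r.
Qed.

Lemma round_cycle_attention (i : 'I_N) :
  fixed_round 2 0 (cycle_attention (lshift true i) 0)
  = DirectedCycle3 R X i 0.
Proof.
rewrite cycle_attentionE; last exact: (ltn_ord i).
have w0 c : 0 <= weight (lshift true i) c by apply: expR_ge0.
rewrite fixed_round_half ?weighted_mean_ge0_le1 // weighted_mean_ge_half //.
  by rewrite cycle_attention_weightP mxE.
by rewrite blank_weightE ltr0n blank_card_gt0.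
Qed.

End CycleAttention.

Theorem theorem24 (R : realType) :
  exists C : R, forall N : nat, (1 <= N)%N ->
  exists p : nat, p%:R <= C * Num.max 1 (ln (N%:R : R)) /\
  exists f : 'M[bool]_N -> 'cV[R]_N,
    TG 3 N 1 1 p f /\ forall X : 'M[bool]_N, f X = DirectedCycle3 R X.
Proof.
(* The precision is 2 for every N and the maximum is at least 1, so C = 2 works. *)
exists 2 => N _; exists 2%N; split.
  by rewrite ler_peMr // le_max lexx.
exists (DirectedCycle3 R (N := N)); split => //.
(* Order 3 means k = 1; then come 0 fractional bits, one blank token and its row 0. *)
exists 1%N => //; exists 0%N, true, 0, (fun i => @vertex_indicator R N _ i).
exists 1%:M, (fun=> 1%:M), (fun=> 1%:M), (cycle_kappa ((N + true) ^ 2)).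
exists (fun=> map_mx (fixed_round 2 0)).
have fixed1 : fixed_mx 2 0 (1%:M : 'M[R]_1).
  by move=> i j; rewrite mxE; apply: fixed_point_bool.
split; [split|by split|] => //.
- by move=> i j; rewrite mxE; apply: (@fixed_point_bool R false).
- move=> i x; split=> // a b; rewrite mxE; exact: fixed_point_bool.
- by move=> i; apply: fixed_mlp_map_round.
- move=> X; apply/matrixP => i j; rewrite ord1 -round_cycle_attention.
  (* Four unfoldings, for [usubmx], [mlp_layer], [map_mx] and [row]; a fifth would open the matrix
     product of the attention. *)
  do 4 rewrite [in RHS]mxE.
  rewrite /cycle_attention.
  congr (fixed_round 2 0 (graph_attention _ _ _ _ _ _ _ _)).
  by apply/matrixP => r s; rewrite !mxE.
Qed.
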